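(* Consider the two-user cooperative NOMA system ($K=2$) with transmit power $\rho>0$ and power coefficients $p_l=p_1^2>0$ (weak user) and $p_h=p_2^2$ (strong user), where $p_l\le p_h$ and $p_l+p_h=1$. Let $\phi_k=2^{R_k}-1$ with $R_k\in\{1,2,3,\dots\}$, $k=1,2$, and let $\mathcal{M_O}=1-\Pr(\gamma_1>\phi_1,\gamma_2>\phi_2)$ be the mutual outage probability, where $\gamma_1=\rho p_l|h_1|^2+\rho|g_{2,1}|^2$ and $\gamma_2=\frac{\rho p_h|h_2|^2}{\rho p_l|h_2|^2+1}$. Put $$\beta=\frac{1}{\rho p_h}\,\frac{\phi_2}{1-\phi_2\frac{p_l}{p_h}},\qquad c=\frac1\rho\left(\phi_1-\frac{\phi_2}{\frac{p_h}{p_l}-\phi_2}\right),\qquad \Delta=\min\left\{c,\frac{\phi_1}{\rho}\right\}.$$ (i) If $\phi_2<\frac{p_h}{p_l}$, then $$\begin{aligned}\mathcal{M_O}=1&-e^{-\frac{\phi_1}{\rho}}\left(1-\left(1-e^{-\beta}\right)^2\right)-\frac{e^{-\frac{2}{p_l}\frac{\phi_1}{\rho}}}{1-\frac{2}{p_l}}\left(1-e^{-\left(1-\frac{2}{p_l}\right)\Delta}\right)\\&-\frac{2e^{-\beta}e^{-\frac{1}{p_l}\frac{\phi_1}{\rho}}}{1-\frac1{p_l}}\left(e^{-c\left(1-\frac1{p_l}\right)}-e^{-\frac{\phi_1}{\rho}\left(1-\frac1{p_l}\right)}\right)+e^{-2\beta}\left(e^{-c}-e^{-\frac{\phi_1}{\rho}}\right).\end{aligned}$$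 (ii) If $\phi_2>\frac{p_h}{p_l}$, then for all sufficiently large $\rho$ one has $\mathcal{M_O}=1$.
   Context: Channel model: let $\mu,\kappa,\delta$ be independent exponential random variables with mean $1$. The base-station-to-user channel power gains, ordered increasingly, are $|h_1|^2=\min\{\mu,\kappa\}$ (weak user, user 1) and $|h_2|^2=\max\{\mu,\kappa\}$ (strong user, user 2). The channel power gain from user 2 to user 1 is $|g_{2,1}|^2=\delta$. The noise has unit variance. $\gamma_1$ is the signal-to-noise ratio of the weak user after combining its two received copies, and $\gamma_2$ is the signal-to-interference-plus-noise ratio of the strong user. $R_k$ is the target rate of user $k$ in bits per channel use.
   Formalization: Part (i) is proved under the added assumption c ≥ 0; for c < 0 the printed formula is false, as it strictly exceeds the true mutual outage probability (e.g. p_l=0.45, p_h=0.55, R_1=R_2=1, ρ=3). *)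

(* Defs.v *)
From HB Require Import structures.
From mathcomp Require Import all_boot all_order all_algebra.
From mathcomp Require Import all_classical all_reals all_analysis.
Import Order.TTheory GRing.Theory Num.Theory.
Import numFieldNormedType.Exports.

Set Implicit Arguments.
Unset Strict Implicit.
Unset Printing Implicit Defensive.

Local Open Scope classical_set_scope.
Local Open Scope ring_scope.

(* [exponential_prob] takes the rate, which is the inverse of the mean. *)
Definition exponential_with_mean (R : realType) (d : measure_display)
    (T : measurableType d) (P : probability T R) (m : R) (X : {RV P >-> R}) :=
  forall A : set R, measurable A ->
    distribution P X A = exponential_prob m^-1 A.

(* Mutual independence; the product rule for subfamilies is the case in which
   some of the sets are [setT]. *)
Definition independent3 (R : realType) (d : measure_display)
    (T : measurableType d) (P : probability T R) (X Y Z : {RV P >-> R}) :=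
  forall A B C : set R, measurable A -> measurable B -> measurable C ->
    P (X @^-1` A `&` Y @^-1` B `&` Z @^-1` C) =
    (P (X @^-1` A) * P (Y @^-1` B) * P (Z @^-1` C))%E.

Section system.
Context {R : realType}.

(* [r] is the target rate in bits per channel use. *)
Definition snr_threshold (r : nat) : R := 2 ^+ r - 1.

(* Channel power gains: h1 = |h_1|^2, h2 = |h_2|^2, g21 = |g_{2,1}|^2;
   the noise variance is 1. *)
Definition gamma1 (rho pl h1 g21 : R) : R := rho * pl * h1 + rho * g21.

Definition gamma2 (rho pl ph h2 : R) : R :=
  rho * ph * h2 / (rho * pl * h2 + 1).

Definition mutual_outage (d : measure_display) (T : measurableType d)
    (P : probability T R) (mu kappa delta : T -> R)
    (pl ph phi1 phi2 rho : R) : \bar R :=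
  let h1 w := Num.min (mu w) (kappa w) in
  let h2 w := Num.max (mu w) (kappa w) in
  (1 - P [set w | (phi1 < gamma1 rho pl (h1 w) (delta w) /\
                   phi2 < gamma2 rho pl ph (h2 w))%R])%E.

End system.

(* Main.v *)
(* Write a = phi1 / rho. Off the null event that mu or kappa is nonpositive,
   success means a < pl * min(mu, kappa) + delta and beta < max(mu, kappa).
   Conditioning on delta = z turns its probability into the mean under the law
   of delta of
     G((a - z) / pl),  G(t) = Pr(t < min(mu, kappa), beta < max(mu, kappa)),
   and G(t) is the mass of the square ]t, +oo[^2 minus that of ]t, beta]^2.
   The mean splits at z = 0, c = a - pl * beta and a, where the sign of t and
   the order of t and beta change; on each piece G is A e^(k z) + B.
   When phi2 > ph / pl, gamma2 stays below ph / pl, so success is null. *)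
From HB Require Import structures.
Require Import Defs.
From mathcomp Require Import all_boot all_order all_algebra.
From mathcomp Require Import all_classical all_reals all_analysis.
From mathcomp Require Import measurable_realfun ring lra.
Import Order.TTheory GRing.Theory Num.Theory.
Import numFieldNormedType.Exports.

Set Implicit Arguments.
Unset Strict Implicit.

Local Open Scope classical_set_scope.
Local Open Scope ring_scope.

(** * Finite measures on a product are determined by rectangles *)

Section product_law.
Local Open Scope ereal_scope.
Context {d1 d2 : measure_display} {T1 : measurableType d1}
  {T2 : measurableType d2} {R : realType}.

(** Measurable rectangles form a pi-system generating the product sigma-algebra, and finiteness lets
    the constant sequence [setT] exhaust the space. *)
Lemma finite_measure_prod_unique
    (m m' : {measure set (T1 * T2)%type -> \bar R}) : m setT < +oo ->
  (forall A B, measurable A -> measurable B -> m (A `*` B) = m' (A `*` B)) ->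
  forall X, measurable X -> m X = m' X.
Proof.
move=> moo mm' X mX.
apply: (measure_unique [set A `*` B | A in measurable & B in measurable]
  (fun=> setT)) => //.
- exact: measurable_prod_measurableType.
- move=> _ _ [A mA [B mB <-]] [A' mA' [B' mB' <-]].
  exists (A `&` A'); first exact: measurableI.
  by exists (B `&` B'); [exact: measurableI|rewrite setXI].
- by move=> _; exists setT => //; exists setT => //; rewrite setXTT.
- by rewrite bigcup_const.
- by move=> _ [A mA [B mB <-]]; exact: mm'.
Qed.

End product_law.

(** * Integration against a measure given by a density *)

Section density.
Local Open Scope ereal_scope.
Context {d : measure_display} {T : measurableType d} {R : realType}.
Variables (nu : {finite_measure set T -> \bar R})
  (mu : {sigma_finite_measure set T -> \bar R}) (g : T -> \bar R).
Hypotheses (mg : measurable_fun [set: T] g)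
  (nuE : forall A, measurable A -> nu A = \int[mu]_(x in A) g x).

(** [g] and the Radon-Nikodym derivative of [nu] have the same integral over every measurable set,
    so they agree [mu]-almost everywhere. The function [f] may change sign. *)
Lemma integral_density (f : T -> \bar R) U : measurable U ->
  nu.-integrable U f ->
  \int[nu]_(x in U) f x = \int[mu]_(x in U) (f x * g x).
Proof.
move=> mU nuf.
have numu : nu `<< mu.
  apply/null_content_dominatesP => A mA muA0.
  by rewrite nuE// (null_set_integral mA)//; exact: measurable_funTS.
rewrite -(Radon_Nikodym_change_of_variables numu)//.
apply: ae_eq_integral => //.
- apply: emeasurable_funM; first exact: (measurable_int nu).
  exact/measurable_funTS/measurable_int/Radon_Nikodym_integrable.
- apply: emeasurable_funM; first exact: (measurable_int nu).
  exact: measurable_funTS.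
- apply: ae_eqe_mul2l; apply: integral_ae_eq => //.
  + by apply: (integrableS measurableT) => //; exact: Radon_Nikodym_integrable.
  + exact: measurable_funTS.
  + by move=> A AU mA; rewrite -nuE// -Radon_Nikodym_integral.
Qed.

End density.

(** * Integrals against the exponential law of mean 1 *)

Section exponential_law.
Context {R : realType}.
Notation mu := (@lebesgue_measure R).
Variable nu : probability (measurableTypeR R) R.
Hypothesis nuE : forall A, measurable A -> nu A = exponential_prob 1 A.

(** Fundamental theorem of calculus: on nonnegative reals the density is [expR (- x)], and
    integrating [expR ((k - 1) * x)] divides by [k - 1]. *)
Lemma expolaw_integral (u v k a b : R) : 0 <= u -> u <= v -> k != 1 ->
  (\int[nu]_(x in `]u, v]) (a * expR (k * x) + b)%:E =
   (a / (k - 1) * (expR ((k - 1) * v) - expR ((k - 1) * u))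
    + b * (expR (- u) - expR (- v)))%:E)%E.
Proof.
move=> u0 uv k1.
have mf : measurable_fun [set: R] (fun x => a * expR (k * x) + b).
  apply: measurable_funD => //; apply: measurable_funM => //.
  exact/measurableT_comp/measurable_funM.
have mpdf := measurable_exponential_pdf (1 : R).
rewrite (integral_density (mu := mu) (g := EFin \o exponential_pdf 1))//;
  last 2 first.
- exact/measurable_EFinP.
- apply: (@le_integrable _ _ _ _ _ _ _
    (EFin \o cst (`|a| * expR (`|k| * v) + `|b|))) => //.
  + exact/measurable_EFinP/measurable_funTS.
  + move=> x /=; rewrite in_itv/= => /andP[ux xv].
    rewrite lee_fin [leRHS]ger0_norm ?addr_ge0 ?mulr_ge0 ?expR_ge0//.
    rewrite (le_trans (ler_normD _ _))// lerD2r normrM ler_wpM2l//.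
    rewrite ger0_norm ?expR_ge0// ler_expR.
    rewrite (le_trans (ler_norm _))// normrM ler_wpM2l//.
    by rewrite ger0_norm// (le_trans u0 (ltW ux)).
  + exact: finite_measure_integrable_cst.
pose F x := a / (k - 1) * expR ((k - 1) * x) - b * expR (- x).
transitivity ((F v)%:E - (F u)%:E)%E; last first.
  by rewrite -EFinB /F; congr EFin; ring.
have k10 : k - 1 != 0 by rewrite subr_eq0.
have F' (x : R) : is_derive x 1 F ((a * expR (k * x) + b) * expR (- x)).
  apply: is_derive_eq; rewrite /GRing.scale/=.
  have -> : expR ((k - 1) * x) = expR (k * x) * expR (- x).
    by rewrite -expRD; congr expR; ring.
  by field.
have cF : continuous F.
  by move=> x; apply/differentiable_continuous/derivable1_diffP.
move: uv; rewrite le_eqVlt => /predU1P[<-|uv].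
  by rewrite set_itvoc0 integral_set0 subee.
(* Adding the Lebesgue-null endpoint [u] gives the closed interval required by [continuous_FTC2]. *)
rewrite integral_itv_obnd_cbnd; last first.
  by apply: measurable_funTS; apply: emeasurable_funM; exact/measurable_EFinP.
rewrite -(continuous_FTC2 (f := fun x => (a * expR (k * x) + b) * expR (- x)) uv).
- apply: eq_integral => x; rewrite inE/= in_itv/= => /andP[ux _].
  rewrite -EFinM exponential_pdfE; last exact: le_trans ux.
  by rewrite mul1r mulN1r.
- apply: continuous_subspaceT => x.
  apply: (@continuousM _ _ (fun x => a * expR (k * x) + b) (fun x => expR (- x))).
    apply/differentiable_continuous/derivable1_diffP; exact: ex_derive.
  apply/differentiable_continuous/derivable1_diffP; exact: ex_derive.
- split; first by move=> x _; exact: ex_derive.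
    exact/cvg_at_right_filter/cF.
  exact/cvg_at_left_filter/cF.
- by move=> x _; rewrite derive1E derive_val.
Qed.

End exponential_law.

(* [R] and [measurableTypeR R] have the same measurable sets but different
   displays; the Lebesgue measure lives on the latter. *)
Section borel.
Context {d : measure_display} {T : measurableType d} {R : realType}
  {P : probability T R}.
Variable X : {RV P >-> R}.

Definition borel : T -> measurableTypeR R := X.

Lemma measurable_borel : measurable_fun [set: T] borel.
Proof. by move=> mT A mA; exact: (measurable_funP X). Qed.

HB.instance Definition _ := isMeasurableFun.Build _ _ _ _ borel measurable_borel.

End borel.

(** * Conditioning on one of three independent variables *)

Section independence.
Local Open Scope ereal_scope.
Context {d : measure_display} {T : measurableType d} {R : realType}.
Variables (P : probability T R) (X Y Z : {RV P >-> R}).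
Hypothesis indep : independent3 X Y Z.

Definition pair_fun (w : T) : R * R := (X w, Y w).

Lemma measurable_pair_fun : measurable_fun [set: T] pair_fun.
Proof. exact: measurable_fun_pair. Qed.

HB.instance Definition _ :=
  isMeasurableFun.Build _ _ _ _ pair_fun measurable_pair_fun.

Lemma independent3_pair (C : set R) (B : set (R * R)) :
  measurable C -> measurable B ->
  P (Z @^-1` C `&` pair_fun @^-1` B) = P (Z @^-1` C) * P (pair_fun @^-1` B).
Proof.
move=> mC mB.
have mZC : measurable (Z @^-1` C) by exact: measurable_funPTI.
have fC : P (Z @^-1` C) = (fine (P (Z @^-1` C)))%:E.
  by rewrite fineK// fin_num_measure.
have PC0 : (0 <= fine (P (Z @^-1` C)))%R by rewrite fine_ge0.
transitivity (pushforward (mrestr P mZC) pair_fun B).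
  by rewrite /pushforward /mrestr/= setIC.
transitivity (mscale (NngNum PC0) (distribution P pair_fun) B); last first.
  by rewrite /mscale/= -fC.
apply: finite_measure_prod_unique mB.
- rewrite /= /pushforward /mrestr/= preimage_setT setTI.
  by rewrite -ge0_fin_numE// fin_num_measure.
- move=> A {}B mA mB.
  transitivity (P (Z @^-1` C) * P (X @^-1` A `&` Y @^-1` B)).
    have := indep mA mB measurableT; rewrite preimage_setT setIT => ->.
    by rewrite probability_setT mule1 muleC -indep// setIC.
  by rewrite [in LHS]fC.
Qed.

(** The joint law of [Z] and the pair is the product of their laws, and a product measure integrates
    the masses of sections. *)
Lemma independent3_prob (B : set (R * (R * R))) : measurable B ->
  P [set w | B (Z w, (X w, Y w))] =
  \int[distribution P (borel Z)]_z P [set w | B (z, (X w, Y w))].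
Proof.
move=> mB.
have sectionE z :
    (distribution P pair_fun \o xsection B) z = P [set w | B (z, (X w, Y w))].
  by congr (P _); apply/seteqP; split => w /=; rewrite /xsection/= inE.
have mS : measurable_fun [set: R] (distribution P pair_fun \o xsection B).
  exact: measurable_fun_xsection.
transitivity (\int[P]_w (distribution P pair_fun \o xsection B) (Z w)).
  rewrite -(ge0_integral_distribution Z mS)//.
  rewrite -[LHS]/(pushforward P (fun w => (Z w, pair_fun w)) B).
  transitivity ((distribution P Z \x distribution P pair_fun) B) => //.
  apply: finite_measure_prod_unique mB => /=.
  - exact: measurable_fun_pair.
  - by move=> ?; rewrite /pushforward preimage_setT probability_setT ltry.
  - move=> ? C D mC mD; rewrite product_measure1E//.
    exact: independent3_pair.
under [RHS]eq_integral do rewrite -sectionE.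
by rewrite ge0_integral_distribution.
Qed.

End independence.

(** * Tails of the exponential law, for thresholds of either sign *)

Section exponential_tail.
Context {R : realType}.
Variable nu : probability (measurableTypeR R) R.
Hypothesis nuE : forall A, measurable A -> nu A = exponential_prob 1 A.

Lemma expolaw_npos : nu `]-oo, 0]%classic = 0%E.
Proof.
(* The density vanishes only on negative reals, so the endpoint 0 is dropped first. *)
rewrite nuE// /exponential_prob -integral_itv_bndo_bndc; last first.
  apply: measurable_funTS; apply/measurable_EFinP.
  exact: measurable_exponential_pdf.
rewrite integral0_eq// => x /=; rewrite in_itv/= => x0.
by rewrite lt0_exponential_pdf.
Qed.

Lemma expolaw_tail (t : R) :
  nu `]t, +oo[%classic = (expR (- Num.max 0 t))%:E.
Proof.
rewrite -setCitvl probability_setC//.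
have [t0|t0] := ltP t 0.
  rewrite (_ : nu _ = 0%E) ?sube0 ?oppr0 ?expR0//.
  apply: (subset_measure0 _ _ _ expolaw_npos) => //.
  by apply: subset_itvl; rewrite bnd_simp ltW.
rewrite (@itv_bndbnd_setU _ _ _ (BRight 0)) ?bnd_simp// measureU//; last first.
  apply/seteqP; split => // x []/=; rewrite !in_itv/= => x0 /andP[].
  by rewrite ltNge x0.
rewrite [X in (1 - (X + _))%E]expolaw_npos add0e.
transitivity (1 - (1 - expR (- t))%:E)%E; last by rewrite -EFinB opprB addrC subrK.
congr (_ - _)%E.
(* The mass of the interval is the integral of 1, put in the shape of [expolaw_integral]. *)
transitivity (\int[nu]_(x in `]0%R, t]) (0 * expR (0 * x) + 1)%:E)%E.
  under eq_integral do rewrite mul0r add0r.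
  by rewrite integral_cst//= mul1e.
rewrite (expolaw_integral nuE)//; last by rewrite eq_sym oner_eq0.
by rewrite !mul0r !add0r oppr0 expR0 mul1r.
Qed.

Lemma expolaw_itvoc (s t : R) : s <= t ->
  nu `]s, t]%classic = (expR (- Num.max 0 s) - expR (- Num.max 0 t))%:E.
Proof.
move=> st.
have := expolaw_tail s.
rewrite (@itv_bndbnd_setU _ _ _ (BRight t)) ?bnd_simp//.
rewrite measureU//=; last first.
  apply/seteqP; split => // x []/=; rewrite !in_itv/= => /andP[_ xt].
  by rewrite andbT ltNge xt.
rewrite expolaw_tail => h.
rewrite EFinB -h addeK//.
Qed.

End exponential_tail.

(** * Joint law of the minimum and maximum of two exponentials *)

Section min_max.
Context {d : measure_display} {T : measurableType d} {R : realType}.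
Variables (P : probability T R) (X Y Z : {RV P >-> R}).
Hypotheses (indep : independent3 X Y Z) (X_exp : exponential_with_mean 1 X)
  (Y_exp : exponential_with_mean 1 Y).

Let rectangle (A B : set (measurableTypeR R)) : measurable A -> measurable B ->
  (P (X @^-1` A `&` Y @^-1` B) =
   distribution P (borel X) A * distribution P (borel Y) B)%E.
Proof.
move=> mA mB; have := indep mA mB measurableT.
by rewrite preimage_setT setIT probability_setT mule1.
Qed.

Let lawX (A : set (measurableTypeR R)) : measurable A ->
  distribution P (borel X) A = exponential_prob 1 A.
Proof. by move=> mA; have := X_exp mA; rewrite invr1 => <-. Qed.

Let lawY (A : set (measurableTypeR R)) : measurable A ->
  distribution P (borel Y) A = exponential_prob 1 A.
Proof. by move=> mA; have := Y_exp mA; rewrite invr1 => <-. Qed.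

Let tailX := expolaw_tail lawX.
Let tailY := expolaw_tail lawY.
Let itvocX := expolaw_itvoc lawX.
Let itvocY := expolaw_itvoc lawY.

Lemma prob_min_gt (t : R) :
  P [set w | t < Num.min (X w) (Y w)] = (expR (- Num.max 0 t) ^+ 2)%:E.
Proof.
rewrite (_ : [set w | _] =
  X @^-1` `]t, +oo[%classic `&` Y @^-1` `]t, +oo[%classic); last first.
  apply/seteqP; split => w /=; rewrite !in_itv/= !andbT lt_min.
    by move=> /andP.
  by move=> [-> ->].
by rewrite rectangle// tailX tailY.
Qed.

Lemma prob_min_gt_max_gt (t b : R) :
  P [set w | t < Num.min (X w) (Y w) /\ b < Num.max (X w) (Y w)] =
  (expR (- Num.max 0 t) ^+ 2 -
   (expR (- Num.max 0 t) - expR (- Num.max 0 (Num.max t b))) ^+ 2)%:E.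
Proof.
(* If [b < t], the bound on the minimum implies the one on the maximum, and the subtracted square
   vanishes. *)
have [tb|bt] := leP t b; last first.
  rewrite subrr expr0n/= subr0 -prob_min_gt; congr (P _).
  apply/seteqP; split => w /= => [[]//|]; rewrite lt_min => /andP[tX tY].
  by rewrite lt_max tX tY (lt_trans bt).
have mq : measurable (X @^-1` `]t, b]%classic `&` Y @^-1` `]t, b]%classic).
  by apply: measurableI; exact: measurable_funPTI.
have mm : measurable (X @^-1` `]t, +oo[%classic `&` Y @^-1` `]t, +oo[%classic).
  by apply: measurableI; exact: measurable_funPTI.
rewrite (_ : [set w | _] =
    (X @^-1` `]t, +oo[%classic `&` Y @^-1` `]t, +oo[%classic) `\`
    (X @^-1` `]t, b]%classic `&` Y @^-1` `]t, b]%classic)); last first.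
  apply/seteqP; split => w /=; rewrite !in_itv/= !andbT lt_min lt_max.
    move=> [/andP[-> ->]] /orP bXY; split => // -[/= Xb Yb].
    by case: bXY; rewrite ltNge ?Xb ?Yb.
  move=> [[-> ->]] /= XYb; split => //.
  by apply: contra_notT XYb; rewrite negb_or -!leNgt => /andP.
have qm : X @^-1` `]t, b]%classic `&` Y @^-1` `]t, b]%classic `<=`
    X @^-1` `]t, +oo[%classic `&` Y @^-1` `]t, +oo[%classic.
  by apply: setISS => w /=; rewrite !in_itv/= andbT => /andP[].
transitivity (P (X @^-1` `]t, +oo[%classic `&` Y @^-1` `]t, +oo[%classic) -
    P (X @^-1` `]t, b]%classic `&` Y @^-1` `]t, b]%classic))%E.
  rewrite measureD ?(setIidr qm)//.
  by rewrite -ge0_fin_numE// fin_num_measure.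
by rewrite !rectangle// tailX tailY itvocX// itvocY.
Qed.

End min_max.

Lemma measurable_setlt {d : measure_display} {T : measurableType d}
    {R : realType} (f g : T -> R) :
  measurable_fun [set: T] f -> measurable_fun [set: T] g ->
  measurable [set w | f w < g w].
Proof.
move=> mf mg; rewrite -[X in measurable X]setTI.
rewrite (_ : [set w | _] = (fun w => f w < g w) @^-1` [set true]).
  exact: measurable_fun_ltr.
by [].
Qed.

(** Used to cut the line at one breakpoint after another; as [x] is a bound rather than a number,
    the first cut can start from minus infinity. *)
Lemma integral_itv_setU {R : realType}
    (m : {measure set (measurableTypeR R) -> \bar R}) (f : R -> \bar R)
    (x : itv_bound R) (t : R) :
  (x <= BRight t)%O -> measurable_fun [set: measurableTypeR R] f ->
  (forall z, 0 <= f z)%E ->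
  (\int[m]_(z in [set` Interval x +oo%O]) f z =
   \int[m]_(z in [set` Interval x (BRight t)]) f z +
   \int[m]_(z in `]t, +oo[) f z)%E.
Proof.
move=> xt mf f0; rewrite (@itv_bndbnd_setU _ _ _ (BRight t)) ?bnd_simp//.
rewrite ge0_integral_setU//=; first exact: measurable_funTS.
apply/disj_setPLR => z /=; rewrite in_itv/= => /andP[_ zt].
by rewrite in_itv/= andbT; apply/negP; rewrite -leNgt.
Qed.

(** * Success probability as an integral over the law of [Z] *)

Section sum_tail.
Context {d : measure_display} {T : measurableType d} {R : realType}.
Variables (P : probability T R) (X Y Z : {RV P >-> R}).
Hypotheses (indep : independent3 X Y Z) (X_exp : exponential_with_mean 1 X)
  (Y_exp : exponential_with_mean 1 Y) (Z_exp : exponential_with_mean 1 Z).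
Variables (a b q : R).
Hypotheses (q0 : 0 < q) (q1 : q != 1) (q2 : q != 2) (b0 : 0 <= b)
  (c0 : 0 <= a - q * b).

Let lawZ (A : set (measurableTypeR R)) : measurable A ->
  distribution P (borel Z) A = exponential_prob 1 A.
Proof. by move=> mA; have := Z_exp mA; rewrite invr1 => <-. Qed.

Lemma measurable_sum_gt :
  measurable [set z : R * (R * R) |
    a < q * Num.min z.2.1 z.2.2 + z.1 /\ b < Num.max z.2.1 z.2.2].
Proof.
have m2 := @measurable_snd _ _ R (R * R)%type.
have m21 : measurable_fun [set: R * (R * R)] (fun z : R * (R * R) => z.2.1).
  exact: measurableT_comp.
have m22 : measurable_fun [set: R * (R * R)] (fun z : R * (R * R) => z.2.2).
  exact: measurableT_comp.
apply: measurableI; apply: measurable_setlt => //.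
- apply: measurable_funD => //; apply: measurable_funM => //.
  exact: measurable_minr.
- exact: measurable_maxr.
Qed.

(** Here [a], [b], [q] stand for [phi1 / rho], [beta], [pl], so [a - q * b] is [c]. The breakpoints
    satisfy [0 <= c <= a], and [q1], [q2] keep the rates [1 / q] and [2 / q] away from 1. *)
Lemma prob_sum_gt :
  P [set w | a < q * Num.min (X w) (Y w) + Z w /\ b < Num.max (X w) (Y w)] =
  (expR (- a) * (1 - (1 - expR (- b)) ^+ 2)
   + expR (- (2 / q * a)) / (1 - 2 / q)
     * (1 - expR (- ((1 - 2 / q) * (a - q * b))))
   + 2 * expR (- b) * expR (- (1 / q * a)) / (1 - 1 / q)
     * (expR (- ((a - q * b) * (1 - 1 / q))) - expR (- (a * (1 - 1 / q))))
   - expR (- (2 * b)) * (expR (- (a - q * b)) - expR (- a)))%:E.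
Proof.
have q_neq0 : q != 0 by rewrite gt_eqF.
have ca : a - q * b <= a by rewrite gerBl mulr_ge0// ltW.
have a0 : 0 <= a by exact: le_trans ca.
rewrite (independent3_prob indep measurable_sum_gt).
(* Given [Z = z], the minimum must exceed [t z]; [G z] is the conditional success probability. *)
pose t z := (a - z) / q.
pose G z := expR (- Num.max 0 (t z)) ^+ 2 -
  (expR (- Num.max 0 (t z)) - expR (- Num.max 0 (Num.max (t z) b))) ^+ 2.
have GE z : P [set w | a < q * Num.min (X w) (Y w) + z /\
    b < Num.max (X w) (Y w)] = (G z)%:E.
  rewrite -(prob_min_gt_max_gt indep X_exp Y_exp).
  congr (P _); apply/seteqP; split => w /= [h ->]; split => //; move: h;
  by rewrite /t ltr_pdivrMr// ltrBlDr mulrC.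
under eq_integral do rewrite GE.
set nu := distribution P (borel Z).
have mt : measurable_fun [set: R] t.
  by apply: measurable_funM => //; exact: measurable_funB.
have mG : measurable_fun [set: measurableTypeR R] (EFin \o G).
  apply/measurable_EFinP.
  have m0t : measurable_fun [set: R] (fun z => expR (- Num.max 0 (t z))).
    apply: measurableT_comp => //; apply: measurableT_comp => //.
    exact: measurable_maxr.
  apply: measurable_funB; first exact: measurable_funX.
  apply: measurable_funX; apply: measurable_funB => //.
  apply: measurableT_comp => //; apply: measurableT_comp => //.
  apply: measurable_maxr => //; exact: measurable_maxr.
have G0 z : (0 <= (G z)%:E)%E by rewrite -GE.
have I1 : (\int[nu]_(z in `]-oo, 0%R]) (G z)%:E = 0)%E.
  by apply: null_set_integral; [|exact: measurable_funTS|exact: expolaw_npos].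
(* Here [b <= t z], so the bound on the maximum is automatic and [G z = expR (- (2 * t z))]. *)
have I2 : (\int[nu]_(z in `]0%R, (a - q * b)%R]) (G z)%:E =
  (expR (- (2 / q * a)) / (1 - 2 / q)
     * (1 - expR (- ((1 - 2 / q) * (a - q * b)))))%:E)%E.
  transitivity (\int[nu]_(z in `]0%R, (a - q * b)%R])
    (expR (- (2 / q * a)) * expR ((2 / q) * z) + 0)%:E)%E.
    apply: eq_integral => z; rewrite inE/= in_itv/= => /andP[z0 zc].
    have bt : b <= t z by rewrite /t ler_pdivlMr//; lra.
    rewrite /G (max_idPl bt) (max_idPr (le_trans b0 bt)) subrr expr0n/= subr0.
    rewrite addr0 -expRD -expRM_natl; congr (expR _)%:E.
    by rewrite /t; field.
  set k := 2 / q.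
  have k1 : k != 1.
    by apply: contra_neq q2 => /(congr1 ( *%R^~ q)); rewrite divfK// mul1r.
  rewrite (expolaw_integral lawZ)// mulr0 expR0 mul0r addr0; congr EFin.
  rewrite (_ : - ((1 - k) * _) = (k - 1) * (a - q * b)); last by ring.
  by field; rewrite !subr_eq0 k1 eq_sym k1.
(* Here [0 <= t z <= b]; expanding the square leaves [2 * expR (- b) * expR (- t z) - expR (- (2 *
   b))]. *)
have I3 : (\int[nu]_(z in `](a - q * b)%R, a]) (G z)%:E =
  (2 * expR (- b) * expR (- (1 / q * a)) / (1 - 1 / q)
     * (expR (- ((a - q * b) * (1 - 1 / q))) - expR (- (a * (1 - 1 / q))))
   - expR (- (2 * b)) * (expR (- (a - q * b)) - expR (- a)))%:E)%E.
  transitivity (\int[nu]_(z in `](a - q * b)%R, a])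
    (2 * expR (- b) * expR (- (1 / q * a)) * expR ((1 / q) * z)
     + (- expR (- (2 * b))))%:E)%E.
    apply: eq_integral => z; rewrite inE/= in_itv/= => /andP[z0 zc].
    have tb : t z <= b by rewrite /t ler_pdivrMr//; lra.
    have t0 : 0 <= t z by rewrite /t divr_ge0 ?subr_ge0// ltW.
    rewrite /G (max_idPr tb) (max_idPr t0) (max_idPr b0).
    rewrite (_ : - t z = - (1 / q * a) + 1 / q * z); last by rewrite /t; field.
    rewrite (_ : - (2 * b) = - b + - b); last by ring.
    by rewrite !expRD; congr EFin; ring.
  set k := 1 / q.
  have k1 : k != 1.
    by apply: contra_neq q1 => /(congr1 ( *%R^~ q)); rewrite divfK// mul1r.
  rewrite (expolaw_integral lawZ)//; congr EFin.
  rewrite (_ : - (_ * (1 - k)) = (k - 1) * (a - q * b)); last by ring.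
  rewrite (_ : - (a * (1 - k)) = (k - 1) * a); last by ring.
  by field; rewrite !subr_eq0 k1 eq_sym k1.
(* Here [t z <= 0]: only the bound on the maximum matters and [G] is constant. *)
have I4 : (\int[nu]_(z in `]a, +oo[) (G z)%:E =
  (expR (- a) * (1 - (1 - expR (- b)) ^+ 2))%:E)%E.
  transitivity (\int[nu]_(z in `]a, +oo[) (1 - (1 - expR (- b)) ^+ 2)%:E)%E.
    apply: eq_integral => z; rewrite inE/= in_itv/= andbT => az.
    have t0 : t z <= 0 by rewrite /t ler_pdivrMr// mul0r subr_le0 ltW.
    rewrite /G (max_idPr (le_trans t0 b0)) (max_idPl t0) (max_idPr b0).
    by rewrite oppr0 expR0 expr1n.
  by rewrite integral_cst//= expolaw_tail// (max_idPr a0) -EFinM mulrC.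
rewrite -set_itvNyy (integral_itv_setU nu (t := 0))// I1.
rewrite (integral_itv_setU nu (t := a - q * b))// I2.
rewrite (integral_itv_setU nu (t := a))// I3 I4 -!EFinD.
by congr EFin; ring.
Qed.

End sum_tail.

(** The total inverse is continuous off 0, and every function is measurable on a singleton. This
    serves the quotient in [gamma2]. *)
Lemma measurable_inv (R : realType) : measurable_fun [set: R] (@GRing.inv R).
Proof.
rewrite -(setUv [set (0 : R)]); apply/measurable_funU => //.
  exact: measurableC.
split; first exact: measurable_fun_set1.
apply: open_continuous_measurable_fun.
  apply: closed_openC.
  exact: accessible_closed_set1 (hausdorff_accessible (@norm_hausdorff _ R)) _.
by move=> x; rewrite inE/= => /eqP x0; exact: inv_continuous.
Qed.

Lemma measure_eq_off_null {d : measure_display} {T : measurableType d}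
    {R : realType} (m : {measure set T -> \bar R}) (A B N : set T) :
  measurable A -> measurable B -> measurable N -> m N = 0%E ->
  A `\` N = B `\` N -> m A = m B.
Proof.
move=> mA mB mN N0 AB.
have off (C : set T) : measurable C -> m C = m (C `\` N).
  move=> mC; rewrite (measureDI m mC mN).
  rewrite [X in (_ + X)%E](subset_measure0 _ mN _ N0) ?adde0//.
  exact: measurableI.
by rewrite off// AB -off.
Qed.

Lemma snr_threshold_ge0 (R : realType) (r : nat) : 0 <= snr_threshold r :> R.
Proof. by rewrite subr_ge0 exprn_ege1// ler1n. Qed.

(** * Reduction of the success event to linear conditions on the gains *)

Section outage.
Context {d : measure_display} {T : measurableType d} {R : realType}.
Variables (P : probability T R) (mu kappa delta : {RV P >-> R}).
Variables (pl ph phi1 phi2 rho : R).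
Hypotheses (mu_exp : exponential_with_mean 1 mu)
  (kappa_exp : exponential_with_mean 1 kappa).
Hypotheses (pl0 : 0 < pl) (ph0 : 0 < ph) (rho0 : 0 < rho).

Let success : set T := [set w |
  phi1 < gamma1 rho pl (Num.min (mu w) (kappa w)) (delta w) /\
  phi2 < gamma2 rho pl ph (Num.max (mu w) (kappa w))].

(** Exponential variables are positive only almost surely; off [N] the denominator of [gamma2] is
    positive. *)
Let N : set T := mu @^-1` `]-oo, 0]%classic `|` kappa @^-1` `]-oo, 0]%classic.

Let npos_null (X : {RV P >-> R}) : exponential_with_mean 1 X ->
  P (X @^-1` `]-oo, 0]%classic) = 0%E.
Proof.
move=> X_exp; apply: (expolaw_npos (nu := distribution P (borel X))).
by move=> A mA; have := X_exp _ mA; rewrite invr1 => <-.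
Qed.

Let mN : measurable N.
Proof. by apply: measurableU; exact: measurable_funPTI. Qed.

Let N0 : P N = 0%E.
Proof.
apply: null_set_setU; [exact: measurable_funPTI|exact: measurable_funPTI| |].
  exact: npos_null mu_exp.
exact: npos_null kappa_exp.
Qed.

Lemma measurable_success : measurable success.
Proof.
have m1 : measurable_fun [set: T] (fun w => Num.min (mu w) (kappa w)).
  exact: measurable_minr.
have m2 : measurable_fun [set: T] (fun w => Num.max (mu w) (kappa w)).
  exact: measurable_maxr.
apply: measurableI; apply: measurable_setlt => //.
- by apply: measurable_funD; apply: measurable_funM.
- apply: measurable_funM; first exact: measurable_funM.
  apply: measurableT_comp; first exact: measurable_inv.
  by apply: measurable_funD => //; exact: measurable_funM.
Qed.

(** Clearing the denominator exposes [ph - phi2 * pl], whose sign separates the two cases of the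
    theorem. *)
Lemma gamma2_gt (h : R) : 0 < h ->
  (phi2 < gamma2 rho pl ph h) = (phi2 < rho * (ph - phi2 * pl) * h).
Proof.
move=> h0; rewrite /gamma2 ltr_pdivlMr ?addr_gt0 ?mulr_gt0//.
by rewrite -subr_gt0 -[RHS]subr_gt0; congr (0 < _); ring.
Qed.

(** Success lies inside [N]: off [N] it would make a product with the single negative factor
    [ph - phi2 * pl] exceed [phi2 > 0]. *)
Lemma success_prob0 : ph / pl < phi2 -> P success = 0%E.
Proof.
rewrite ltr_pdivrMr// => h; apply: (subset_measure0 measurable_success mN) => //.
move=> w [_ s2]; apply: contrapT => /not_orP[/=].
rewrite !in_itv/= => /negP; rewrite -ltNge => m0 /negP; rewrite -ltNge => k0.
have h0 : 0 < Num.max (mu w) (kappa w) by rewrite lt_max m0.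
move: s2; rewrite gamma2_gt// => s2.
have phi20 : 0 < phi2 by rewrite -(pmulr_lgt0 _ pl0) (lt_trans ph0).
have := lt_trans phi20 s2.
by rewrite pmulr_lgt0// pmulr_rgt0// subr_gt0 ltNge (ltW h).
Qed.

(** Off [N] the two events coincide, on dividing by the positive numbers [rho] and
    [rho * (ph - phi2 * pl)]. *)
Lemma success_prob : phi2 < ph / pl -> 0 <= phi2 ->
  P success = P [set w |
    phi1 / rho < pl * Num.min (mu w) (kappa w) + delta w /\
    phi2 / (rho * (ph - phi2 * pl)) < Num.max (mu w) (kappa w)].
Proof.
rewrite ltr_pdivlMr// => h phi20.
apply: (measure_eq_off_null (N := N)) => //.
- exact: measurable_success.
- have mm : measurable_fun [set: T] (fun w => (delta w, (mu w, kappa w))).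
    by apply: measurable_fun_pair => //; exact: measurable_fun_pair.
  have := mm measurableT _ (measurable_sum_gt (phi1 / rho)
    (phi2 / (rho * (ph - phi2 * pl))) pl).
  by rewrite setTI.
apply/seteqP; split => w [/= [s1 s2]] /[dup] Nw /not_orP[/=];
  rewrite !in_itv/= => /negP; rewrite -ltNge => m0 /negP; rewrite -ltNge => k0;
  split=> //=; (have h0 : 0 < Num.max (mu w) (kappa w) by rewrite lt_max m0).
  split; first by rewrite ltr_pdivrMr// mulrDl ![_ * rho]mulrC mulrA.
  by rewrite ltr_pdivrMr ?mulr_gt0 ?subr_gt0// mulrC -gamma2_gt.
split; last first.
  by rewrite gamma2_gt// mulrC -ltr_pdivrMr ?mulr_gt0 ?subr_gt0.
by move: s1; rewrite ltr_pdivrMr// mulrDl ![_ * rho]mulrC mulrA.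
Qed.

End outage.

Theorem proposition1 (R : realType) (d : measure_display)
    (T : measurableType d) (P : probability T R)
    (mu kappa delta : {RV P >-> R})
    (mu_exp : exponential_with_mean 1 mu)
    (kappa_exp : exponential_with_mean 1 kappa)
    (delta_exp : exponential_with_mean 1 delta)
    (indep : independent3 mu kappa delta)
    (p1 p2 pl ph : R) (plE : pl = p1 ^+ 2) (phE : ph = p2 ^+ 2)
    (pl_gt0 : 0 < pl) (pl_le_ph : pl <= ph) (plDph : pl + ph = 1)
    (R1 R2 : nat) (R1_gt0 : (0 < R1)%N) (R2_gt0 : (0 < R2)%N)
    (phi1 phi2 : R)
    (phi1E : phi1 = snr_threshold R1) (phi2E : phi2 = snr_threshold R2) :
  (forall rho : R, 0 < rho ->
    let beta := 1 / (rho * ph) * (phi2 / (1 - phi2 * (pl / ph))) in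
    let c := 1 / rho * (phi1 - phi2 / (ph / pl - phi2)) in
    let Delta := Num.min c (phi1 / rho) in
    phi2 < ph / pl -> 0 <= c ->
    mutual_outage P mu kappa delta pl ph phi1 phi2 rho =
    (1
     - expR (- (phi1 / rho)) * (1 - (1 - expR (- beta)) ^+ 2)
     - expR (- (2 / pl * (phi1 / rho))) / (1 - 2 / pl)
       * (1 - expR (- ((1 - 2 / pl) * Delta)))
     - 2 * expR (- beta) * expR (- (1 / pl * (phi1 / rho))) / (1 - 1 / pl)
       * (expR (- (c * (1 - 1 / pl)))
          - expR (- (phi1 / rho * (1 - 1 / pl))))
     + expR (- (2 * beta)) * (expR (- c) - expR (- (phi1 / rho))))%:E)
  /\
  (ph / pl < phi2 ->
    \forall rho \near +oo_R,
      mutual_outage P mu kappa delta pl ph phi1 phi2 rho = 1%E).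
Proof.
have ph_gt0 : 0 < ph by exact: lt_le_trans pl_le_ph.
have phi2_ge0 : 0 <= phi2 by rewrite phi2E snr_threshold_ge0.
split=> [rho rho_gt0 beta c Delta phi2_lt c_ge0|phi2_gt]; last first.
  (* Every positive [rho] already gives outage 1. *)
  near=> rho.
  have rho_gt0 : 0 < rho by near: rho; exact: nbhs_pinfty_gt.
  by rewrite /mutual_outage success_prob0// sube0.
have D_gt0 : 0 < ph - phi2 * pl by rewrite subr_gt0 -ltr_pdivlMr.
have betaE : phi2 / (rho * (ph - phi2 * pl)) = beta.
  rewrite /beta; field.
  by rewrite !gt_eqF.
have beta_ge0 : 0 <= beta by rewrite -betaE divr_ge0// mulr_ge0 ?ltW.
(* This identifies [c] with the breakpoint [a - q * b]; as [beta >= 0], it is at most [phi1 / rho],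
   whence [Delta = c]. *)
have cE : c = phi1 / rho - pl * beta.
  rewrite /c -betaE; field.
  by rewrite !gt_eqF.
have DeltaE : Delta = c.
  by apply/min_idPl; rewrite cE gerBl mulr_ge0// ltW.
(* From [pl <= ph] and [pl + ph = 1], [pl] is at most one half. *)
have pl_neq1 : pl != 1 by rewrite lt_eqF//; lra.
have pl_neq2 : pl != 2 by rewrite lt_eqF//; lra.
rewrite /mutual_outage success_prob// betaE.
rewrite (prob_sum_gt indep mu_exp kappa_exp delta_exp)// -?cE//.
rewrite DeltaE -EFinB; congr EFin; ring.
Unshelve. all: by end_near.
Qed.
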